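(* Let $n\ge 2$, $d$ and $k>0$ be integers and let $\alpha\in\mathbb{R}$. Suppose $G(\alpha;n,d,k)$ is non-empty, and let the integers $a,t$ be defined by $d=na-t$ with $0\le t<n$. Then $$\alpha>\frac{t}{k}.$$ Moreover, if $(E,V)$ is a coherent system of type $(n,d,k)$ on $\mathbb{P}^1$ such that $E$ has generic splitting type, and $\alpha>\frac{t}{k}$ holds, then every coherent subsystem $(E',V')$ of $(E,V)$ of type $(r,d',0)$ satisfies the $\alpha$-stability condition $\mu_\alpha(E',V')<\mu_\alpha(E,V)$.
   Context: Work on the projective line $\mathbb{P}^1$ over an algebraically closed field. A coherent system of type $(n,d,k)$ is a pair $(E,V)$ where $E$ is a vector bundle of rank $n$ and degree $d$ on $\mathbb{P}^1$ and $V\subset H^0(E)$ is a vector subspace of dimension $k$. For $\alpha\in\mathbb{R}$ its $\alpha$-slope is $\mu_\alpha(E,V)=\frac{d}{n}+\alpha\frac{k}{n}$. A coherent subsystem of $(E,V)$ is a coherent system $(E',V')$ with $E'$ a (nonzero) subbundle of $E$ and $V'\subset V\cap H^0(E')$; it is proper if $(E',V')\neq(E,V)$. $(E,V)$ is $\alpha$-stable if $\mu_\alpha(E',V')<\mu_\alpha(E,V)$ for every proper coherent subsystem $(E',V')$. $G(\alpha;n,d,k)$ denotes the moduli space of $\alpha$-stable coherent systems of type $(n,d,k)$ on $\mathbb{P}^1$. A bundle $E$ of rank $n$ and degree $d=na-t$, $0\le t<n$, is of generic splitting type if $E\simeq\mathcal{O}(a)^{n-t}\oplus\mathcal{O}(a-1)^t$.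 *)

(* Defs.v *)
From HB Require Import structures.
From mathcomp Require Import all_boot all_order all_algebra fraction generic_quotient.
From mathcomp Require Import all_classical reals.
From mathcomp Require Import ring lra zify.
Set Implicit Arguments.
Unset Strict Implicit.
Unset Printing Implicit Defensive.
Import Order.TTheory GRing.Theory Num.Theory.
Local Open Scope quotient_scope.
Local Open Scope classical_set_scope.
Local Open Scope ring_scope.

(* Vector bundles on P^1 over an algebraically closed field F are modelled as
   locally free subsheaves of constant sheaves.  On an integral scheme with
   function field K every vector bundle of rank n is isomorphic to one of this
   form: a basis of the generic fibre embeds it into the constant sheaf K^n,
   and its stalk at p becomes M_p O_p^n for some M_p in GL_n(K). *)

(* Closed points of P^1: Some x is the point z = x, None is the point at
   infinity. *)
Notation P1 F := (option F).

(* The function field F(z) of P^1. *)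
Notation ratfun F := {fraction {poly F}}.

Local Notation tofrac := (@FracField.tofrac _).

Section RationalFunctions.
Variable F : closedFieldType.
Implicit Types (p q : P1 F) (f g : {poly F}) (u v : ratfun F).

Definition constK (c : F) : ratfun F := tofrac c%:P.

Definition zK : ratfun F := tofrac 'X.

(* Order of vanishing of a nonzero polynomial; at infinity it is minus the
   degree, and size f = deg f + 1. *)
Definition pord p f : int :=
  if p is Some x then (mup x f)%:Z else 1 - (size f)%:Z.

(* Order of vanishing of a nonzero rational function (meaningless at 0). *)
Definition ord p u : int := pord p \n_(repr u) - pord p \d_(repr u).

(* Membership in the local ring O_p. *)
Definition regular_at p u : bool := (u == 0) || (0 <= ord p u).

Definition mx_regular_at p m n (A : 'M[ratfun F]_(m, n)) : Prop :=
  forall i j, regular_at p (A i j).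

(* The nonempty Zariski-open subsets of P^1 are the cofinite ones. *)
Definition cofinite_open (U : set (P1 F)) : Prop := finite_set (~` U).

Lemma pordM p f g : f != 0 -> g != 0 -> pord p (f * g) = pord p f + pord p g.
Proof.
move=> f0 g0; case: p => [x|] /=; first by rewrite mupM.
rewrite size_mul //; move: f0 g0; rewrite -!size_poly_gt0.
by move: (size f) (size g) => a b; lia.
Qed.

Lemma ratfunE u : u = tofrac \n_(repr u) / tofrac \d_(repr u).
Proof.
have d0 : tofrac \d_(repr u) != 0 by rewrite tofrac_eq0 denom_ratioP.
apply: (mulIf d0); rewrite divfK //.
rewrite -{1}[u]reprK /FracField.tofrac; unlock.
rewrite -[LHS]FracField.pi_mul; apply/eqmodP.
by rewrite /= FracField.equivfE /FracField.mulf !numden_Ratio ?oner_neq0 ?mulf_neq0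
  ?denom_ratioP ?oner_neq0 // !mulr1 mulrC.
Qed.

Lemma ord_div p f g : f != 0 -> g != 0 ->
  ord p (tofrac f / tofrac g) = pord p f - pord p g.
Proof.
move=> f0 g0; rewrite /ord; set u := _ / _.
have d0 : \d_(repr u) != 0 by exact: denom_ratioP.
have u0 : u != 0 by rewrite mulf_neq0 ?invr_eq0 ?tofrac_eq0.
have n0 : \n_(repr u) != 0.
  by apply: contraNneq u0 => n0; rewrite (ratfunE u) n0 tofrac0 mul0r.
have /eqP : u = tofrac \n_(repr u) / tofrac \d_(repr u) by exact: ratfunE.
rewrite {1}/u eqr_div ?tofrac_eq0 // -!tofracM tofrac_eq => /eqP e.
have /eqP := congr1 (pord p) e; rewrite !pordM // => h.
by apply/eqP; move: h; move: (pord p f) (pord p g) (pord p \n_(repr u)) (pord p \d_(repr u)) => a b c d; lia.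
Qed.

Lemma ratfun_num_neq0 u : u != 0 -> \n_(repr u) != 0.
Proof.
by move=> u0; apply: contraNneq u0 => n0; rewrite (ratfunE u) n0 tofrac0 mul0r.
Qed.

Lemma ordM p u v : u != 0 -> v != 0 -> ord p (u * v) = ord p u + ord p v.
Proof.
move=> u0 v0.
have nu := ratfun_num_neq0 u0; have nv := ratfun_num_neq0 v0.
have du : \d_(repr u) != 0 by exact: denom_ratioP.
have dv : \d_(repr v) != 0 by exact: denom_ratioP.
have := ord_div p (mulf_neq0 nu nv) (mulf_neq0 du dv).
rewrite (pordM p nu nv) (pordM p du dv) !tofracM -mulf_div -!ratfunE => ->.
rewrite /ord; move: (pord p _) (pord p _) (pord p _) (pord p _) => a b c e.
lia.
Qed.

Lemma ord_one p : ord p 1 = 0.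
Proof.
have := @ord_div p 1 1 (oner_neq0 _) (oner_neq0 _).
by rewrite tofrac1 divr1 subrr.
Qed.

Lemma ordV p u : u != 0 -> ord p u^-1 = - ord p u.
Proof.
move=> u0; apply/eqP; rewrite -addr_eq0 -ordM ?invr_eq0 // mulVf //.
by apply/eqP; exact: ord_one.
Qed.

Lemma zK_neq0 : zK != 0.
Proof. by rewrite tofrac_eq0 polyX_eq0. Qed.

Lemma ord_zK p : ord p zK = if p is Some x then (x == 0)%:Z else -1.
Proof.
have := @ord_div p 'X 1; rewrite polyX_eq0 oner_eq0 => /(_ isT isT).
rewrite tofrac1 divr1 -/zK => ->; case: p => [x|] /=; last first.
  by rewrite size_polyX size_poly1.
rewrite -['X]subr0 -[0 in X in X - _]/(0%:P) -['X - _]expr1 mup_XsubCX.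
by rewrite mupNroot ?root1 // eq_sym; case: eqP.
Qed.

Lemma ord_zKX p (m : int) : ord p (zK ^ m) = m * ord p zK.
Proof.
have X (n : nat) : ord p (zK ^+ n) = n%:Z * ord p zK.
  elim: n => [|n IH]; first by rewrite expr0 ord_one mul0r.
  by rewrite exprS ordM ?expf_neq0 ?zK_neq0 // IH; lia.
case: m => n; first exact: X.
rewrite NegzE -invr_expz ordV ?expf_neq0 ?zK_neq0 //.
by rewrite (X n.+1) mulNr.
Qed.

End RationalFunctions.

Section Bundles.
Variable F : closedFieldType.
Local Notation K := (ratfun F).

(* frame E p is M_p, so that E_p = M_p O_p^n.  Local triviality: on a
   neighbourhood of p, E is the free sheaf generated by the columns of M_p. *)
Record bundle (n : nat) := Bundle {
  frame :> P1 F -> 'M[K]_n;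
  frame_unit : forall p, frame p \in unitmx;
  frame_loc : forall p, exists U : set (P1 F),
    [/\ cofinite_open U, U p &
      forall q, U q -> mx_regular_at q (invmx (frame q) *m frame p) /\
                       mx_regular_at q (invmx (frame p) *m frame q)] }.

(* The stalk of det E at p is det(M_p) O_p, so det E = O(D) for the divisor
   D = - sum_p ord_p(det M_p) p.  The sum has finite support. *)
Definition deg n (E : bundle n) : int :=
  - (\sum_(p \in [set: P1 F]) ord p (\det (E p)))%R.

Definition H0 n (E : bundle n) : set 'cV[K]_n :=
  [set s | forall p, mx_regular_at p (invmx (E p) *m s)].

(* A morphism of bundles is determined by its K-linear map on generic fibres;
   it must carry stalks into stalks. *)
Definition is_hom r n (E' : bundle r) (E : bundle n) (A : 'M[K]_(n, r)) :=
  forall p, mx_regular_at p (invmx (E p) *m A *m E' p).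

Definition is_iso r n (E' : bundle r) (E : bundle n) (A : 'M[K]_(n, r)) :=
  is_hom E' E A /\
  exists B : 'M[K]_(r, n), [/\ is_hom E E' B, B *m A = 1%:M & A *m B = 1%:M].

Definition isomorphic r n (E' : bundle r) (E : bundle n) :=
  exists A, is_iso E' E A.

(* A embeds E' as a subbundle of E, i.e. locally as a direct summand: on each
   stalk the map O_p^r -> O_p^n has an O_p-linear retraction. *)
Definition is_subbundle r n (E' : bundle r) (E : bundle n)
    (A : 'M[K]_(n, r)) :=
  is_hom E' E A /\
  forall p, exists2 B : 'M[K]_(r, n), mx_regular_at p B &
    B *m (invmx (E p) *m A *m E' p) = 1%:M.

(* V is an F-linear subspace of dimension m of K^n. *)
Definition is_subspace_of_dim n (m : nat) (V : set 'cV[K]_n) :=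
  exists b : 'I_m -> 'cV[K]_n,
    (forall c : 'I_m -> F, \sum_i constK (c i) *: b i = 0 ->
       forall i, c i = 0) /\
    V = [set v | exists c : 'I_m -> F, v = \sum_i constK (c i) *: b i].

Record coherent_system (n k : nat) := CoherentSystem {
  cs_bundle : bundle n;
  cs_space : set 'cV[K]_n;
  cs_sections : cs_space `<=` H0 cs_bundle;
  cs_dim : is_subspace_of_dim k cs_space }.

(* The embedding A identifies E' with a subbundle of E and V' with a subspace
   of V; that V' lies in H^0(E') is part of S'. *)
Definition is_subsystem r k' n k (S' : coherent_system r k')
    (S : coherent_system n k) (A : 'M[K]_(n, r)) :=
  [/\ (0 < r)%N, is_subbundle (cs_bundle S') (cs_bundle S) A &
      [set A *m s | s in cs_space S'] `<=` cs_space S].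

(* Properness: the image of S' under A is not all of S. *)
Definition is_proper_subsystem r k' n k (S' : coherent_system r k')
    (S : coherent_system n k) (A : 'M[K]_(n, r)) :=
  is_subsystem S' S A /\
  ~ (is_iso (cs_bundle S') (cs_bundle S) A /\
     [set A *m s | s in cs_space S'] = cs_space S).

Definition mu (R : realType) (alpha : R) n k (S : coherent_system n k) : R :=
  (deg (cs_bundle S))%:~R / n%:R + alpha * (k%:R / n%:R).

Definition alpha_stable (R : realType) (alpha : R) n k
    (S : coherent_system n k) :=
  forall r k' (S' : coherent_system r k') (A : 'M[K]_(n, r)),
    is_proper_subsystem S' S A -> mu alpha S' < mu alpha S.

(* The alpha-stable coherent systems of type (n, d, k); the points of
   G(alpha; n, d, k) are their isomorphism classes. *)
Definition G (R : realType) (alpha : R) (n : nat) (d : int) (k : nat) :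
    set (coherent_system n k) :=
  [set S | deg (cs_bundle S) = d /\ alpha_stable alpha S].

Lemma mx_regular_at_scalar (p : P1 F) (n : nat) (u : K) :
  regular_at p u -> mx_regular_at p (u%:M : 'M_n).
Proof.
move=> ru i j; rewrite !mxE; case: eqP => _; rewrite ?mulr1n // mulr0n.
by rewrite /regular_at eqxx.
Qed.

Lemma regular_at1 (p : P1 F) : regular_at p 1.
Proof. by rewrite /regular_at [ord _ _](ord_one p) orbT. Qed.

(* The sheaf O(m): the sections over the finite points are generated by 1 and
   those near infinity by z^m. *)
Definition O_frame (m : int) (p : P1 F) : 'M[K]_1 :=
  if p is Some _ then 1%:M else (zK F ^ m)%:M.

Lemma O_frame_unit m p : O_frame m p \in unitmx.
Proof.
case: p => [x|]; rewrite /O_frame ?unitmx1 //.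
by rewrite unitmxE det_scalar expr1 unitfE expfz_neq0 ?zK_neq0.
Qed.

Lemma O_frame_loc m p : exists U : set (P1 F),
  [/\ cofinite_open U, U p &
    forall q, U q -> mx_regular_at q (invmx (O_frame m q) *m O_frame m p) /\
                     mx_regular_at q (invmx (O_frame m p) *m O_frame m q)].
Proof.
have R1 q : mx_regular_at q (1%:M : 'M[K]_1).
  exact/mx_regular_at_scalar/regular_at1.
case: p => [x|].
  exists (~` [set None]); split => //.
    by rewrite /cofinite_open setCK; exact: finite_set1.
  case=> [y _|]; last by move/(_ erefl).
  by rewrite /O_frame invmx1 mulmx1; split; exact: R1.
exists (~` [set Some 0]); split => //.
  by rewrite /cofinite_open setCK; exact: finite_set1.
case=> [y|] y0; last first.
  by rewrite !mulVmx ?O_frame_unit //; split; exact: R1.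
have {}y0 : y != 0 by apply/eqP => e; apply: y0; rewrite e.
have o0 j : ord (Some y) (zK F ^ j) = 0.
  by rewrite ord_zKX ord_zK (negbTE y0) mulr0.
rewrite /O_frame invmx1 mul1mx mulmx1 invmx_scalar invr_expz.
by split; apply: mx_regular_at_scalar; rewrite /regular_at o0 lexx orbT.
Qed.

Definition OO (m : int) : bundle 1 :=
  @Bundle 1 (O_frame m) (O_frame_unit m) (O_frame_loc m).

Definition dsum_frame n (L : 'I_n -> bundle 1) (p : P1 F) : 'M[K]_n :=
  diag_mx (\row_i L i p 0 0).

Lemma dsum_frame_unit n (L : 'I_n -> bundle 1) p : dsum_frame L p \in unitmx.
Proof.
rewrite unitmxE det_diag unitfE; apply/prodf_neq0 => i _; rewrite mxE.
by have := frame_unit (L i) p; rewrite unitmxE unitfE det_mx11.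
Qed.

Lemma dsum_frame_loc n (L : 'I_n -> bundle 1) p : exists U : set (P1 F),
  [/\ cofinite_open U, U p &
    forall q, U q -> mx_regular_at q (invmx (dsum_frame L q) *m dsum_frame L p) /\
                     mx_regular_at q (invmx (dsum_frame L p) *m dsum_frame L q)].
Proof.
have [U UP] := choice (fun i => frame_loc (L i) p).
exists (\bigcap_(i in [set: 'I_n]) U i); split.
- rewrite /cofinite_open setC_bigcap; apply: bigcup_finite => // i _.
  by case: (UP i).
- by move=> i _; case: (UP i).
have E1 i q : L i q 0 0 != 0.
  by have := frame_unit (L i) q; rewrite unitmxE unitfE det_mx11.
have Einv q q' : invmx (dsum_frame L q) *m dsum_frame L q' =
    diag_mx (\row_i ((L i q 0 0)^-1 * L i q' 0 0)).
  rewrite -[RHS](mulKmx (dsum_frame_unit L q)); congr (_ *m _).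
  rewrite /dsum_frame mulmx_diag; congr diag_mx.
  by apply/rowP => i; rewrite !mxE mulrA mulfV ?mul1r.
have E2 i q q' : (L i q 0 0)^-1 * L i q' 0 0 = (invmx (L i q) *m L i q') 0 0.
  rewrite mxE big_ord1; congr (_ * _).
  have e : L i q = (L i q 0 0)%:M by rewrite [LHS]mx11_scalar.
  by rewrite [in RHS]e invmx_scalar mxE mulr1n.
have Rdiag q (d : 'rV[K]_n) : (forall i, regular_at q (d 0 i)) ->
    mx_regular_at q (diag_mx d).
  move=> rd i j; rewrite mxE; case: eqP => _; rewrite ?mulr1n // mulr0n.
  by rewrite /regular_at eqxx.
move=> q Uq.
have H i := let: And3 _ _ h := UP i in h q (Uq i I).
split.
  rewrite (Einv q p); apply: (Rdiag q) => i; rewrite mxE E2.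
  by case: (H i) => h _; apply: h.
rewrite (Einv p q); apply: (Rdiag q) => i; rewrite mxE E2.
by case: (H i) => _ h; apply: h.
Qed.

Definition dsum n (L : 'I_n -> bundle 1) : bundle n :=
  @Bundle n (dsum_frame L) (dsum_frame_unit L) (dsum_frame_loc L).

Definition generic_splitting n (E : bundle n) : Prop :=
  exists (a : int) (t : nat), [/\ (t < n)%N, deg E = n%:Z * a - t%:Z &
    isomorphic E (dsum (fun i : 'I_n => OO (if (i < n - t)%N then a else a - 1)))].

End Bundles.

Arguments G F {R} alpha n d k.

(* Main.v *)
Require Import Defs.
From mathcomp Require Import all_boot all_order all_algebra.
From mathcomp Require Import all_classical reals.
From mathcomp Require Import fraction ring zify.
Set Implicit Arguments.
Unset Strict Implicit.
Unset Printing Implicit Defensive.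
Import Order.TTheory GRing.Theory Num.Theory.
Local Open Scope classical_set_scope.
Local Open Scope ring_scope.

(** Since d = n a - t, the inequality alpha > t / k says exactly that the integer a
lies strictly below the alpha-slope of a system of type (n, d, k) (lt_mu), and
the alpha-slope of a subsystem without sections is the ordinary slope of its
bundle.  Both halves therefore compare a with degrees of subbundles.

For the necessity, every bundle on the projective line is a direct sum of line
bundles O(e_i) (Grothendieck_splitting).  The e_i add up to d > n (a - 1), so
one of them is at least a; this summand, taken with no sections, is a proper
subsystem of slope at least a, and stability gives a < mu_alpha(E, V).

For the converse, let E be of generic splitting type, so that its summands have
degree a or a - 1, and let E' be a subbundle of rank r.  Some r x r minor of
E' -> E is nonzero, hence r of the summands receive a generically injective map
from E', and so deg E' <= r a (deg_le_of_hom_dsum).  The slope of E' is thus at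
most a.

Both rest on one degree computation (deg_hom): for a generically bijective
morphism A : E' -> E of bundles of the same rank, deg E - deg E' is the sum over
the points p of the order of det A in local frames at p.  These orders are
nonnegative, and A is an isomorphism as soon as they all vanish.

The splitting theorem is proved by maximality.  Clearing poles of a generic frame
gives some generically bijective morphism from a sum of O(e_i) to E, and the
sum of the e_i is at most deg E.  If its determinant vanishes at p, a
constant-coefficient relation between its columns on the fiber at p allows one
column to be replaced by a combination divisible by the equation of p, which
raises one e_i by 1 (raise_degree).  This must stop, and then the morphism is an
isomorphism. *)

Local Notation "f %:F" := (@FracField.tofrac _ f).

(** * Valuations and residues on the function field *)

Section Valuations.
Variable F : closedFieldType.
Local Notation K := (ratfun F).
Implicit Types (p q : P1 F) (u v w : K) (m n : int) (f g : {poly F}).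

(** u belongs to the m-th power, m in Z, of the maximal ideal at p.  For m = 0 this is
convertible to regular_at p u, which is what lets the lemmas on val_ge apply to
matrices that are regular at p. *)
Definition val_ge p m u : bool := (u == 0) || (m <= ord p u).

Lemma ratfun_ind (P : K -> Prop) :
  (forall f g, g != 0 -> P (f%:F / g%:F)) -> forall u, P u.
Proof. by move=> H u; rewrite (ratfunE u); apply: H; exact: denom_ratioP. Qed.

Lemma val_ge_frac p m f g : f != 0 -> g != 0 ->
  val_ge p m (f%:F / g%:F) = (m <= pord p f - pord p g).
Proof.
move=> f0 g0; rewrite /val_ge ord_div // mulf_eq0 invr_eq0 !tofrac_eq0.
by rewrite (negbTE f0) (negbTE g0).
Qed.

Lemma val_ge0 p m : val_ge p m 0.
Proof. by rewrite /val_ge eqxx. Qed.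

Lemma val_geW p m n u : n <= m -> val_ge p m u -> val_ge p n u.
Proof.
by rewrite /val_ge => nm /orP[->//|/(le_trans nm) ->]; rewrite orbT.
Qed.

Lemma val_geM p m n u v : val_ge p m u -> val_ge p n v -> val_ge p (m + n) (u * v).
Proof.
rewrite /val_ge mulf_eq0; case: eqVneq => //= u0 mu; case: eqVneq => //= v0 nv.
by rewrite (ordM _ u0 v0); exact: lerD.
Qed.

(** The case m = n = 0 of val_geM, where 0 + 0 would obstruct unification. *)
Lemma regularM p u v : val_ge p 0 u -> val_ge p 0 v -> val_ge p 0 (u * v).
Proof. exact: val_geM. Qed.

Lemma pordD p f g m : f != 0 -> g != 0 -> f + g != 0 ->
  m <= pord p f -> m <= pord p g -> m <= pord p (f + g).
Proof.
move=> f0 g0 fg0; case: p => [x|] /=; last first.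
  have := size_polyD f g; move: (size f) (size g) (size _) => a b c; lia.
(* A negative bound holds at a finite point, where orders are natural numbers. *)
case: m => [m|m]; last by [].
by rewrite !lez_nat !mup_geq // => *; exact: dvdp_add.
Qed.

Lemma val_geD p m u v : val_ge p m u -> val_ge p m v -> val_ge p m (u + v).
Proof.
elim/ratfun_ind: u => f g g0; elim/ratfun_ind: v => f' g' g'0.
have [->|f0] := eqVneq f 0; first by rewrite tofrac0 mul0r add0r.
have [->|f'0] := eqVneq f' 0; first by rewrite tofrac0 mul0r addr0.
rewrite addf_div ?tofrac_eq0 // -!tofracM -tofracD.
have [->|s0] := eqVneq (f * g' + f' * g) 0.
  by rewrite tofrac0 mul0r val_ge0.
rewrite !val_ge_frac ?mulf_neq0 // pordM // => a b.
rewrite lerBrDr; apply: pordD; rewrite ?mulf_neq0 // pordM //.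
  move: a b; move: (pord p _) (pord p _) (pord p _) (pord p _) => *; lia.
move: a b; move: (pord p _) (pord p _) (pord p _) (pord p _) => *; lia.
Qed.

Lemma constK0 : constK (0 : F) = 0.
Proof. by rewrite /constK polyC0 tofrac0. Qed.
Lemma constK1 : constK (1 : F) = 1.
Proof. by rewrite /constK polyC1 tofrac1. Qed.
Lemma constKD : {morph @constK F : c d / c + d}.
Proof. by move=> c d; rewrite /constK polyCD tofracD. Qed.
Lemma constKM : {morph @constK F : c d / c * d}.
Proof. by move=> c d; rewrite /constK polyCM tofracM. Qed.
Lemma constKN : {morph @constK F : c / - c}.
Proof. by move=> c; rewrite /constK polyCN tofracN. Qed.
Lemma constK_eq0 (c : F) : (constK c == 0) = (c == 0).
Proof. by rewrite /constK tofrac_eq0 polyC_eq0. Qed.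

Lemma ord_constK p (c : F) : c != 0 -> ord p (constK c) = 0.
Proof.
move=> c0; have := @ord_div F p c%:P 1; rewrite polyC_eq0 oner_eq0.
move=> /(_ c0 isT); rewrite tofrac1 divr1 => ->; case: p => [x|] /=.
  have r1 : ~~ root (1 : {poly F}) x by rewrite root1.
  have rc : ~~ root c%:P x by rewrite rootC.
  by rewrite (mupNroot r1) (mupNroot rc) subrr.
by rewrite size_poly1 size_polyC c0 subrr.
Qed.

Lemma regular_constK p (c : F) : val_ge p 0 (constK c).
Proof.
have [->|c0] := eqVneq c 0; first by rewrite constK0 val_ge0.
by rewrite /val_ge ord_constK // lexx orbT.
Qed.

Lemma regular1 p : val_ge p 0 1.
Proof. by rewrite -constK1 regular_constK. Qed.

Lemma val_geN p m u : val_ge p m (- u) = val_ge p m u.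
Proof.
suff H v : val_ge p m v -> val_ge p m (- v).
  by apply/idP/idP => /H //; rewrite opprK.
move=> mv; rewrite -mulN1r -constK1 -constKN -[m]add0r.
by apply: val_geM => //; exact: regular_constK.
Qed.

Lemma val_geB p m u v : val_ge p m u -> val_ge p m v -> val_ge p m (u - v).
Proof. by move=> mu mv; rewrite val_geD // val_geN. Qed.

Lemma val_ge_sum p m (I : finType) (G : I -> K) :
  (forall i, val_ge p m (G i)) -> val_ge p m (\sum_i G i).
Proof.
move=> H; elim/big_ind: _ => [|u v|//]; [exact: val_ge0 | exact: val_geD].
Qed.

Lemma regular_prod p (I : finType) (G : I -> K) :
  (forall i, val_ge p 0 (G i)) -> val_ge p 0 (\prod_i G i).
Proof.
move=> H; elim/big_ind: _ => [|u v hu hv|//]; first exact: regular1.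
exact: regularM.
Qed.

Lemma val_ge1_frac_finite (x : F) f g : root f x -> ~~ root g x ->
  val_ge (Some x) 1 (f%:F / g%:F).
Proof.
move=> fx gx; have [->|f0] := eqVneq f 0; first by rewrite tofrac0 mul0r val_ge0.
have g0 : g != 0 by apply: contraNneq gx => ->; rewrite root0.
by rewrite val_ge_frac //= (mupNroot gx) subr0 lez_nat -XsubC_dvd // dvdp_XsubCl.
Qed.

(** The residue field at p is F.  Where u has order 0, its residue is the value
at the point of the reduced fraction if p is finite, and the quotient of the
leading coefficients if p is at infinity. *)
Lemma residue p u : val_ge p 0 u -> exists c : F, val_ge p 1 (u - constK c).
Proof.
have [->|u0] := eqVneq u 0.
  by exists 0; rewrite constK0 subr0 val_ge0.
rewrite /val_ge (negbTE u0) /= le_eqVlt => /orP[/eqP|] ou; last first.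
  by exists 0; rewrite constK0 subr0 (negbTE u0).
move: u0 ou; elim/ratfun_ind: u => f g g0.
rewrite mulf_eq0 invr_eq0 !tofrac_eq0 (negbTE g0) orbF => f0.
rewrite ord_div // => /esym/eqP; rewrite subr_eq0 => /eqP.
case: p => [x|] /=.
  case=> fg.
  have factor h : h != 0 -> exists2 h', h = h' * ('X - x%:P) ^+ mup x h & ~~ root h' x.
    move=> h0; have := mup_geq x (mup x h) h0; rewrite leqnn => /esym/dvdpP[h' e].
    exists h' => //; rewrite -dvdp_XsubCl; apply/negP => /dvdpP[k e'].
    have : (mup x h < mup x h)%N.
      by rewrite mup_geq // [X in _ %| X]e e' -mulrA -exprS dvdp_mull.
    by rewrite ltnn.
  have [f' ef fx] := factor _ f0; have [g' eg gx] := factor _ g0.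
  exists (f'.[x] / g'.[x]).
  have X0 : ('X - x%:P) ^+ mup x g != 0 by rewrite expf_neq0 // polyXsubC_eq0.
  have -> : f%:F / g%:F = f'%:F / g'%:F :> K.
    rewrite fg in ef; move: X0 ef eg; move: (_ ^+ _) => pi pi0 -> ->.
    rewrite (tofracM f') (tofracM g') -mulf_div.
    have -> : pi%:F / pi%:F = 1 by apply: divff; rewrite tofrac_eq0.
    by rewrite mulr1.
  have g'0 : g' != 0 by apply: contraNneq gx => ->; rewrite root0.
  have -> : f'%:F / g'%:F - constK (f'.[x] / g'.[x]) =
            (f' - (f'.[x] / g'.[x])%:P * g')%:F / g'%:F.
    by rewrite tofracB tofracM mulrBl mulfK // tofrac_eq0.
  apply: val_ge1_frac_finite => //.
  by rewrite rootE hornerD hornerN hornerM hornerC divfK ?subrr.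
move=> e; have sfg : size f = size g by move: e; move: (size f) (size g) => a b; lia.
pose c := lead_coef f / lead_coef g; exists c.
have -> : f%:F / g%:F - constK c = (f - c *: g)%:F / g%:F.
  by rewrite -mul_polyC tofracB tofracM mulrBl mulfK // tofrac_eq0.
have [->|s0] := eqVneq (f - c *: g) 0.
  by rewrite tofrac0 mul0r eqxx.
have := @val_ge_frac None 1 _ _ s0 g0; rewrite /val_ge => -> /=.
suff : (size (f - c *: g)%R < size g)%N by move: (size (f - c *: g)) (size g) => a b; lia.
have sg : (0 < size g)%N by rewrite size_poly_gt0.
rewrite -(ltn_predK sg) ltnS; apply/leq_sizeP => j.
rewrite leq_eqVlt => /orP[/eqP <-|jg]; rewrite coefB coefZ.
  by rewrite /c !lead_coefE sfg divfK ?subrr // -lead_coefE lead_coef_eq0.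
have gj : (size g <= j)%N by move: jg sg; move: (size g) => b; lia.
by rewrite !nth_default ?sfg // mulr0 subrr.
Qed.

End Valuations.

(** * Principal divisors have degree zero *)

Section ProductFormula.
Variable F : closedFieldType.
Local Notation K := (ratfun F).
Implicit Types (p q : P1 F) (u v w : K) (D : P1 F -> int).

Definition supp D : set (P1 F) := [set p | D p != 0].

Lemma sum_suppE D (A : set (P1 F)) : supp D `<=` A ->
  \sum_(p \in [set: P1 F]) D p = \sum_(p \in A) D p.
Proof.
move=> sA; apply/esym/fsbig_widen => // p [_ nA].
by apply/eqP; apply: contrapT => /negP D0; apply: nA; apply: sA.
Qed.

Lemma finite_supp_add D D' : finite_set (supp D) -> finite_set (supp D') ->
  finite_set (supp (fun p => D p + D' p)).
Proof.
move=> fD fD'; have : finite_set (supp D `|` supp D') by rewrite finite_setU.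
apply: sub_finite_set => p; rewrite /supp /=.
have [->|] := eqVneq (D p) 0; last by left.
by rewrite add0r; right.
Qed.

Lemma finite_supp_opp D : finite_set (supp D) -> finite_set (supp (fun p => - D p)).
Proof. by apply: sub_finite_set => p; rewrite /supp /= oppr_eq0. Qed.

Lemma sum_points_add D D' : finite_set (supp D) -> finite_set (supp D') ->
  \sum_(p \in [set: P1 F]) (D p + D' p) =
  \sum_(p \in [set: P1 F]) D p + \sum_(p \in [set: P1 F]) D' p.
Proof.
move=> fD fD'; have fA : finite_set (supp D `|` supp D') by rewrite finite_setU.
rewrite !(@sum_suppE _ (supp D `|` supp D')).
- exact: fsbig_split.
- exact: subsetUr.
- exact: subsetUl.
- move=> p /=; rewrite /supp /=; have [->|] := eqVneq (D p) 0; last by left.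
  by rewrite add0r; right.
Qed.

Definition divisor u : P1 F -> int := fun p => ord p u.

Definition principal D := finite_set (supp D) /\ \sum_(p \in [set: P1 F]) D p = 0.

Lemma principal_add D D' : principal D -> principal D' ->
  principal (fun p => D p + D' p).
Proof.
move=> [fD sD] [fD' sD']; split; first exact: finite_supp_add.
by rewrite sum_points_add // sD sD'.
Qed.

Lemma principal_opp D : principal D -> principal (fun p => - D p).
Proof.
move=> [fD sD]; split; first exact: finite_supp_opp.
under eq_fsbigr do rewrite -mulN1r.
by rewrite -mulr_fsumr sD mulr0.
Qed.

Lemma ord_XsubC (x : F) p :
  ord p ('X - x%:P)%:F = if p is Some y then (y == x)%:Z else -1.
Proof.
have := @ord_div F p ('X - x%:P) 1; rewrite polyXsubC_eq0 oner_eq0.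
move=> /(_ isT isT); rewrite tofrac1 divr1 => ->; case: p => [y|] /=.
  have r1 : ~~ root (1 : {poly F}) y by rewrite root1.
  rewrite (mupNroot r1) subr0 -['X - _]expr1 mup_XsubCX eq_sym.
  by case: (_ == _).
by rewrite size_XsubC size_poly1.
Qed.

Lemma XsubC_neq0 (x : F) : ('X - x%:P)%:F != 0 :> K.
Proof. by rewrite tofrac_eq0 polyXsubC_eq0. Qed.

Lemma principal_XsubC (r : F) : principal (divisor ('X - r%:P)%:F).
Proof.
have -> : divisor ('X - r%:P)%:F =
    fun p : P1 F => if p is Some x then (x == r)%:Z else -1.
  by apply/funext => p; exact: ord_XsubC.
have sub : supp (fun p : P1 F => if p is Some x then (x == r)%:Z else -1) `<=`
    [set` [:: Some r; None]].
  move=> [x|] /=; last by rewrite !inE.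
  by have [->|xr] := eqVneq x r; rewrite /supp /= ?mem_head // (negbTE xr).
split; first by exact: sub_finite_set sub (finite_seq _).
rewrite (sum_suppE sub) -fsbig_seq // !big_cons big_nil eqxx.
by [].
Qed.

Lemma principal_tofrac (f : {poly F}) : f != 0 -> principal (divisor f%:F).
Proof.
move=> f0; have [s ->] := closed_field_poly_normal f.
rewrite -mul_polyC tofracM.
have l0 : lead_coef f != 0 by rewrite lead_coef_eq0.
have pr0 (s' : seq F) : (\prod_(z <- s') ('X - z%:P))%:F != 0 :> K.
  by rewrite tofrac_eq0 monic_neq0 // monic_prod_XsubC.
have -> : divisor ((lead_coef f)%:P%:F * (\prod_(z <- s) ('X - z%:P))%:F) =
    divisor (\prod_(z <- s) ('X - z%:P))%:F.
  apply/funext => p; rewrite /divisor ordM ?pr0 ?constK_eq0 //.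
  by rewrite ord_constK // add0r.
elim: s => [|r s IH].
  rewrite big_nil tofrac1.
  have -> : divisor 1 = (fun=> 0) :> (P1 F -> int) by apply/funext => p; exact: ord_one.
  split; last by rewrite fsbig1.
  by have := @finite_set0 (P1 F); apply: sub_finite_set => p.
have -> : divisor (\prod_(z <- r :: s) ('X - z%:P))%:F =
    (fun p => ord p ('X - r%:P)%:F + ord p (\prod_(z <- s) ('X - z%:P))%:F).
  apply/funext => p; rewrite /divisor big_cons tofracM ordM ?pr0 //.
  by rewrite tofrac_eq0 polyXsubC_eq0.
by apply: principal_add => //; exact: principal_XsubC.
Qed.

(** Over an algebraically closed field a rational function is a constant times
a product of factors z - r and their inverses, and z - r has a simple zero at r
and a simple pole at infinity. *)
Lemma product_formula u : u != 0 -> principal (divisor u).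
Proof.
elim/ratfun_ind: u => f g g0.
rewrite mulf_eq0 invr_eq0 !tofrac_eq0 (negbTE g0) orbF => f0.
have -> : divisor (f%:F / g%:F) = (fun p => ord p f%:F + - ord p g%:F).
  by apply/funext => p; rewrite /divisor ordM ?ordV ?invr_eq0 ?tofrac_eq0.
by apply: principal_add (principal_opp _); exact: principal_tofrac.
Qed.

End ProductFormula.

(** * Matrices over the local rings *)

Section RegularMatrices.
Variable F : closedFieldType.
Local Notation K := (ratfun F).
Implicit Types (p : P1 F).

Lemma mx_regular_mul p m n l (A : 'M[K]_(m, n)) (B : 'M[K]_(n, l)) :
  mx_regular_at p A -> mx_regular_at p B -> mx_regular_at p (A *m B).
Proof.
move=> rA rB i j; rewrite mxE; apply: val_ge_sum => s.
by apply: regularM; [exact: rA|exact: rB].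
Qed.

Lemma regular_sign p (b : nat) : val_ge p 0 ((-1) ^+ b : K).
Proof.
elim: b => [|b IH]; first exact: regular1.
by rewrite exprS mulN1r val_geN.
Qed.

Lemma regular_det p n (A : 'M[K]_n) : mx_regular_at p A -> val_ge p 0 (\det A).
Proof.
move=> rA; apply: val_ge_sum => s.
apply: regularM; first exact: regular_sign.
by apply: regular_prod => i; apply: rA.
Qed.

Lemma regular_invmx p n (A : 'M[K]_n) : A \in unitmx -> mx_regular_at p A ->
  ord p (\det A) = 0 -> mx_regular_at p (invmx A).
Proof.
move=> uA rA o0 i j; rewrite /invmx uA !mxE; apply: regularM.
  rewrite /val_ge ordV; first by rewrite o0 oppr0 lexx orbT.
  by rewrite -unitfE -unitmxE.
apply: regularM; first exact: regular_sign.
by apply: regular_det => k l; rewrite !mxE; apply: rA.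
Qed.

Definition cong p (u : K) (c : F) := val_ge p 1 (u - constK c).

Lemma cong_regular p u c : cong p u c -> val_ge p 0 u.
Proof.
move=> uc; rewrite -[u](subrK (constK c)); apply: val_geD (regular_constK _ _).
exact: val_geW uc.
Qed.

Lemma congD p u c v d : cong p u c -> cong p v d -> cong p (u + v) (c + d).
Proof. by move=> uc vd; rewrite /cong constKD opprD addrACA val_geD. Qed.

Lemma congM p u c v d : cong p u c -> cong p v d -> cong p (u * v) (c * d).
Proof.
move=> uc vd; rewrite /cong constKM.
have -> : u * v - constK c * constK d =
    (u - constK c) * v + constK c * (v - constK d) by ring.
apply: val_geD; first by rewrite -[1]addr0; apply: val_geM (cong_regular vd).
by rewrite -[1]add0r; apply: val_geM => //; exact: regular_constK.
Qed.

Lemma cong_constK p (c : F) : cong p (constK c) c.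
Proof. by rewrite /cong subrr val_ge0. Qed.

Lemma cong_det p n (A : 'M[K]_n) (C : 'M[F]_n) :
  (forall i j, cong p (A i j) (C i j)) -> cong p (\det A) (\det C).
Proof.
move=> AC; rewrite /determinant.
elim/big_ind2: _ => [|u c v d|s _]; first by rewrite -{1}constK0; exact: cong_constK.
  exact: congD.
apply: congM.
  elim: (nat_of_bool _) => [|b IH]; first by rewrite -constK1; exact: cong_constK.
  by rewrite !exprS; apply: congM => //; rewrite -constK1 -constKN; exact: cong_constK.
elim/big_ind2: _ => [|u c v d|i _]; first by rewrite -{1}constK1; exact: cong_constK.
  exact: congM.
exact: AC.
Qed.

(** The determinant of the matrix of residues is the residue of the determinant;
if it vanishes, a kernel vector over F gives the relation. *)
Lemma degenerate_fiber p n (A : 'M[K]_n) : mx_regular_at p A ->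
    val_ge p 1 (\det A) ->
  exists2 c : 'cV[F]_n, c != 0 &
    forall i, val_ge p 1 (\sum_j A i j * constK (c j 0)).
Proof.
move=> rA dA.
have /choice[C0 C0P] : forall ij : 'I_n * 'I_n, exists c, cong p (A ij.1 ij.2) c.
  by move=> ij; apply: residue; apply: rA.
pose C := \matrix_(i, j) C0 (i, j).
have AC i j : cong p (A i j) (C i j) by rewrite mxE; exact: (C0P (i, j)).
have detC0 : \det C = 0.
  apply/eqP; apply/negP => /negP d0.
  have : val_ge p 1 (constK (\det C)).
    by rewrite -[constK _](subKr (\det A)); apply: val_geB => //; exact: cong_det.
  by rewrite /val_ge constK_eq0 (negbTE d0) ord_constK.
have {detC0} /eqP/det0P[c c0 cC] : \det C^T = 0 by rewrite det_tr.
exists c^T; first by rewrite trmx_eq0.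
move=> i; have : cong p (\sum_j A i j * constK (c^T j 0)) (\sum_j C i j * c^T j 0).
  elim/big_ind2: _ => [|u a v d|j _]; first by rewrite -{1}constK0; exact: cong_constK.
    exact: congD.
  by apply: congM => //; exact: cong_constK.
have -> : \sum_j C i j * c^T j 0 = 0.
  have /matrixP/(_ 0 i) := cC; rewrite !mxE => e; apply: (etrans _ e).
  by apply: eq_bigr => j _; rewrite !mxE mulrC.
by rewrite /cong constK0 subr0.
Qed.

End RegularMatrices.

(** * Degrees and generically bijective morphisms *)

Lemma unitmx_conj (R : fieldType) n (X A Y : 'M[R]_n) :
  X \in unitmx -> A \in unitmx -> Y \in unitmx -> invmx X *m A *m Y \in unitmx.
Proof. by move=> uX uA uY; rewrite !unitmx_mul unitmx_inv uX uA uY. Qed.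

Lemma invmx_conj (R : fieldType) n (X A Y : 'M[R]_n) :
  X \in unitmx -> A \in unitmx -> Y \in unitmx ->
  invmx (invmx X *m A *m Y) = invmx Y *m invmx A *m X.
Proof.
move=> uX uA uY; have uH := unitmx_conj uX uA uY.
apply: (can_inj (mulKmx uH)); rewrite mulmxV // !mulmxA.
by rewrite (mulmxK uY) (mulmxK uA) mulVmx.
Qed.

Section Degrees.
Variable F : closedFieldType.
Local Notation K := (ratfun F).
Implicit Types (p q : P1 F).

Lemma det_frame_neq0 n (E : bundle F n) p : \det (E p) != 0.
Proof. by have := frame_unit E p; rewrite unitmxE unitfE. Qed.

Lemma ord_eq_of_regular p (u v : K) : u != 0 -> v != 0 ->
  val_ge p 0 (u^-1 * v) -> val_ge p 0 (v^-1 * u) -> ord p u = ord p v.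
Proof.
move=> u0 v0; rewrite /val_ge !mulf_eq0 !invr_eq0 (negbTE u0) (negbTE v0) /=.
rewrite (ordM p (invr_neq0 u0) v0) (ordM p (invr_neq0 v0) u0) (ordV p u0) (ordV p v0).
move: (ord p u) (ord p v) => a b; lia.
Qed.

(** Around the point at infinity, det E is trivialized by the single function
det (E None) on a cofinite set. *)
Lemma supp_det_frame n (E : bundle F n) :
  finite_set (supp (fun p => ord p (\det (E p)))).
Proof.
have [U [cU _ UP]] := frame_loc E None.
have [fD _] := product_formula (det_frame_neq0 E None).
have : finite_set (~` U `|` supp (divisor (\det (E None)))) by rewrite finite_setU.
apply: sub_finite_set => q /= oq.
have [Uq|] := pselect (U q); [right|by left].
have [/regular_det r1 /regular_det r2] := UP q Uq.
move: oq; rewrite /supp /divisor /=; apply: contraNN => /eqP <-; apply/eqP.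
move: r1; rewrite det_mulmx det_inv => r1.
move: r2; rewrite det_mulmx det_inv => r2.
exact: ord_eq_of_regular (det_frame_neq0 _ _) (det_frame_neq0 _ _) r1 r2.
Qed.

Section Hom.
Variables (n : nat) (E' E : bundle F n) (A : 'M[K]_n).
Hypothesis uA : A \in unitmx.

Let detA0 : \det A != 0. Proof. by move: uA; rewrite unitmxE unitfE. Qed.

Lemma det_hom_neq0 p : \det (invmx (E p) *m A *m E' p) != 0.
Proof.
rewrite det_mulmx (det_mulmx _ A) det_inv.
have E0 := det_frame_neq0 E p; have E'0 := det_frame_neq0 E' p.
exact: mulf_neq0 (mulf_neq0 (invr_neq0 E0) detA0) E'0.
Qed.

(** The local determinant is det A det E'_p / det E_p, and the divisor of the
rational function det A sums to zero. *)
Lemma deg_hom :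
  \sum_(p \in [set: P1 F]) ord p (\det (invmx (E p) *m A *m E' p)) = deg E - deg E'.
Proof.
have oE p : ord p (\det (invmx (E p) *m A *m E' p)) =
    (ord p (\det (E' p)) + divisor (\det A) p) + - ord p (\det (E p)).
  have E0 := det_frame_neq0 E p; have E'0 := det_frame_neq0 E' p.
  rewrite det_mulmx (det_mulmx _ A) det_inv (ordM p (mulf_neq0 (invr_neq0 E0) detA0) E'0).
  by rewrite (ordM p (invr_neq0 E0) detA0) (ordV p E0) addrC addrA addrAC.
under eq_fsbigr do rewrite oE.
have [fA sA] := product_formula detA0.
have fE := supp_det_frame E; have fE' := supp_det_frame E'.
rewrite sum_points_add.
- rewrite sum_points_add // sA addr0 /deg opprK addrC; congr (_ + _).
  under eq_fsbigr do rewrite -mulN1r.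
  by rewrite -mulr_fsumr mulN1r.
- exact: finite_supp_add.
- exact: finite_supp_opp.
Qed.

Hypothesis hA : is_hom E' E A.

Lemma ord_hom_ge0 p : 0 <= ord p (\det (invmx (E p) *m A *m E' p)).
Proof.
by have := regular_det (hA p); rewrite /val_ge (negbTE (det_hom_neq0 p)).
Qed.

Lemma deg_le_of_inj_hom : deg E' <= deg E.
Proof.
rewrite -subr_ge0 -deg_hom; apply: fsumr_ge0 => p _; exact: ord_hom_ge0.
Qed.

(** The inverse of a matrix over a local ring is regular when the determinant
is a unit of that ring. *)
Lemma iso_of_hom : (forall p, ord p (\det (invmx (E p) *m A *m E' p)) = 0) ->
  is_iso E' E A.
Proof.
move=> o0; split; first exact: hA.
exists (invmx A); split; [move=> p|exact: mulVmx|exact: mulmxV].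
have uE := frame_unit E p; have uE' := frame_unit E' p.
rewrite -(invmx_conj uE uA uE').
exact: (regular_invmx (unitmx_conj uE uA uE') (hA p) (o0 p)).
Qed.

End Hom.

Lemma iso_unit n (E' E : bundle F n) A : is_iso E' E A -> A \in unitmx.
Proof. by case=> _ [B [_ BA _]]; case/mulmx1_unit: BA. Qed.

Lemma deg_iso n (E' E : bundle F n) A : is_iso E' E A -> deg E' = deg E.
Proof.
move=> iA; have uA := iso_unit iA; case: iA => hA [B [hB BA AB]].
have [uB _] := mulmx1_unit BA.
by apply/eqP; rewrite eq_le (deg_le_of_inj_hom uA hA) (deg_le_of_inj_hom uB hB).
Qed.

Lemma is_hom_comp n1 n2 n3 (E1 : bundle F n1) (E2 : bundle F n2) (E3 : bundle F n3)
    A B : is_hom E1 E2 A -> is_hom E2 E3 B -> is_hom E1 E3 (B *m A).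
Proof.
move=> hA hB p.
have -> : invmx (E3 p) *m (B *m A) *m E1 p =
    (invmx (E3 p) *m B *m E2 p) *m (invmx (E2 p) *m A *m E1 p).
  by rewrite !mulmxA (mulmxK (frame_unit E2 p)).
exact: mx_regular_mul.
Qed.

Lemma deg_dsum n (L : 'I_n -> bundle F 1) : deg (dsum L) = \sum_i deg (L i).
Proof.
have L0 i p : L i p 0 0 != 0 by rewrite -det_mx11 det_frame_neq0.
pose D i p := ord p (L i p 0 0).
have fD i : finite_set (supp (D i)).
  have := supp_det_frame (L i); apply: sub_finite_set => p.
  by rewrite /supp /D /= det_mx11.
have H (s : seq 'I_n) :
    finite_set (supp (fun p => ord p (\prod_(i <- s) L i p 0 0))) /\
    \sum_(p \in [set: P1 F]) ord p (\prod_(i <- s) L i p 0 0) =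
    \sum_(i <- s) \sum_(p \in [set: P1 F]) D i p.
  elim: s => [|i s [fs es]].
    have e0 p : ord p (\prod_(i <- [::]) L i p 0 0) = 0 by rewrite big_nil ord_one.
    split; last by rewrite big_nil fsbig1.
    have := @finite_set0 (P1 F); apply: sub_finite_set => p.
    by rewrite /supp /= e0.
  have eS p : ord p (\prod_(j <- i :: s) L j p 0 0) =
      D i p + ord p (\prod_(j <- s) L j p 0 0).
    rewrite big_cons ordM //.
    by rewrite prodf_seq_neq0; apply/allP => j _; rewrite L0.
  split; first by rewrite (funext eS); exact: finite_supp_add.
  under eq_fsbigr do rewrite eS.
  by rewrite sum_points_add // es big_cons.
have dE p : ord p (\det (dsum L p)) = ord p (\prod_i L i p 0 0).
  congr (ord p _); rewrite det_diag; apply: eq_bigr => i _; exact: mxE.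
rewrite /deg; under eq_fsbigr do rewrite dE.
have [_ ->] := H (index_enum 'I_n).
rewrite -sumrN; apply: eq_bigr => i _; congr (- _).
by apply: eq_fsbigr => p _; rewrite /D det_mx11.
Qed.

(** The local generator at p of O(m). *)
Definition twist p (m : int) : K := if p is Some _ then 1 else zK F ^ m.

Lemma twist_neq0 p m : twist p m != 0.
Proof. by case: p => [x|] /=; rewrite ?oner_neq0 // expfz_neq0 // zK_neq0. Qed.

Lemma ord_twist p m q : ord q (twist p m) = if p is Some _ then 0 else m * ord q (zK F).
Proof. by case: p => [x|]; [exact: ord_one|exact: ord_zKX]. Qed.

Lemma OO_frameE m p : OO F m p 0 0 = twist p m.
Proof. by case: p => [x|]; rewrite /= mxE eqxx mulr1n. Qed.

Lemma deg_OO m : deg (OO F m) = m.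
Proof.
have e p : ord p (\det (OO F m p)) = if p is Some _ then 0 else - m.
  rewrite det_mx11 OO_frameE ord_twist; case: p => [x|] //.
  by rewrite ord_zK mulrN1.
rewrite /deg; under eq_fsbigr do rewrite e.
rewrite (@sum_suppE _ _ [set None]); last by case.
by rewrite fsbig_set1 opprK.
Qed.

Lemma dsum_frameE n (L : 'I_n -> bundle F 1) p m (M : 'M[K]_(m, n)) i j :
  (M *m dsum L p) i j = M i j * L j p 0 0.
Proof. by rewrite /= /dsum_frame mul_mx_diag !mxE. Qed.

Lemma dsum_frameVE n (L : 'I_n -> bundle F 1) p m (M : 'M[K]_(n, m)) i j :
  (invmx (dsum L p) *m M) i j = (L i p 0 0)^-1 * M i j.
Proof.
have L0 : L i p 0 0 != 0 by rewrite -det_mx11 det_frame_neq0.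
have e (N : 'M[K]_(n, m)) : (dsum L p *m N) i j = L i p 0 0 * N i j.
  by rewrite /= /dsum_frame mul_diag_mx !mxE.
have := e (invmx (dsum L p) *m M).
by rewrite (mulKVmx (frame_unit (dsum L) p)) => ->; rewrite mulKf.
Qed.

(** B forces C to have rank r, so r of its rows form an invertible matrix; they
map E' to the sum of the corresponding r line bundles. *)
Lemma deg_le_of_hom_dsum r n (E' : bundle F r) (L : 'I_n -> bundle F 1) (a : int)
    (C : 'M[K]_(n, r)) (B : 'M[K]_(r, n)) :
  (forall i, deg (L i) <= a) -> is_hom E' (dsum L) C -> B *m C = 1%:M ->
  deg E' <= r%:Z * a.
Proof.
move=> La hC BC.
have fullC : row_full C.
  by rewrite /row_full eqn_leq rank_leq_col -{1}(mxrank1 K r) -BC mxrankM_maxr.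
pose f := fullrankfun fullC.
have uf : rowsub f C \in unitmx by exact: fullrowsub_unit.
have hf : is_hom E' (dsum (L \o f)) (rowsub f C).
  move=> p i j; rewrite -mulmxA dsum_frameVE mul_rowsub_mx mxE /=.
  by rewrite -dsum_frameVE mulmxA; exact: hC.
apply: le_trans (deg_le_of_inj_hom uf hf) _; rewrite deg_dsum.
apply: le_trans (ler_sum _ (fun i _ => La (f i))) _.
by rewrite sumr_const card_ord -mulr_natl natz.
Qed.

End Degrees.

(** * Grothendieck's splitting theorem *)

Section Splitting.
Variable F : closedFieldType.
Local Notation K := (ratfun F).
Implicit Types (p q : P1 F).

Definition sumOO n (e : 'I_n -> int) : bundle F n := dsum (fun i => OO F (e i)).

Lemma sumOO_frameE n (e : 'I_n -> int) p m (M : 'M[K]_(m, n)) i j :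
  (M *m sumOO e p) i j = M i j * twist p (e j).
Proof. by rewrite dsum_frameE OO_frameE. Qed.

Lemma deg_sumOO n (e : 'I_n -> int) : deg (sumOO e) = \sum_i e i.
Proof. by rewrite deg_dsum; apply: eq_bigr => i _; exact: deg_OO. Qed.

(** With s an equation of p, t1 the generator of O(1), and ti, tk those of O(e_i),
O(e_k): the k-th term of a new column equals the old k-th column times c, times
the transition factors (g ti / tk) and t1 / s that govern its regularity. *)
Lemma new_column_termE (L : fieldType) (x c g ti t1 s tk : L) : s != 0 -> tk != 0 ->
  x * (s^-1 * (c * g)) * (ti * t1) = t1 / s * (x * tk * c * (g * ti / tk)).
Proof. by move=> s0 tk0; field; rewrite s0 tk0. Qed.

Lemma bounded_pole p m n (A : 'M[K]_(m, n)) :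
  exists k : nat, forall i j, val_ge p (- k%:Z) (A i j).
Proof.
exists (\max_(ij : 'I_m * 'I_n) `|ord p (A ij.1 ij.2)|%N) => i j.
have := @leq_bigmax _ (fun ij : 'I_m * 'I_n => `|ord p (A ij.1 ij.2)|%N) (i, j).
rewrite /val_ge /=; move: (\max_(ij : _) _)%N (ord p (A i j)) => k o.
by move=> ko; apply/orP; right; lia.
Qed.

(** h is a product of powers of z - x for the finite points x of s, so it adds
no pole at finite distance. *)
Lemma clear_poles n (N : P1 F -> 'M[K]_n) (s : seq (P1 F)) :
  exists h : K, [/\ h != 0, forall y, val_ge (Some y) 0 h &
    forall y, Some y \in s -> forall i j, val_ge (Some y) 0 (h * N (Some y) i j)].
Proof.
elim: s => [|[x|] s [h [h0 hr hs]]].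
- by exists 1; split=> [|y|//]; [exact: oner_neq0 | exact: regular1].
- have [k kP] := bounded_pole (Some x) (N (Some x)).
  have [l l0 lE] : exists2 l : K, l != 0 &
      forall y, ord (Some y) l = (k * (y == x))%:Z.
    exists (('X - x%:P)%:F ^+ k) => [|y]; first exact: expf_neq0 (XsubC_neq0 x).
    elim: (k) => [|k' IH]; first by rewrite expr0 mul0n; exact: ord_one.
    rewrite exprS (ordM _ (XsubC_neq0 x) (expf_neq0 k' (XsubC_neq0 x))) IH.
    by rewrite ord_XsubC mulSn.
  have lr y : val_ge (Some y) 0 l by rewrite /val_ge lE orbT.
  exists (l * h); split=> [|y|y ys i j]; first exact: (mulf_neq0 l0 h0).
    exact: regularM (lr y) (hr y).
  rewrite -mulrA; have [yx|yx] := eqVneq y x.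
    rewrite mulrCA; apply: regularM => //.
    have := kP i j; rewrite -yx => kij.
    rewrite -[0](subrr k%:Z); apply: val_geM => //.
    by rewrite /val_ge lE yx eqxx muln1 lexx orbT.
  apply: regularM => //; apply: hs.
  by move: ys; rewrite inE => /orP[/eqP[]|//] /eqP; rewrite (negbTE yx).
- by exists h; split=> // y ys; apply: hs.
Qed.

(** The frame of E at infinity, as a basis of the generic fiber, generates the
other stalks at all but finitely many points.  After clearing its poles by h, the
pole of h at infinity is absorbed by the twist O(ord_oo h). *)
Lemma exists_sumOO_hom n (E : bundle F n) :
  exists (e : 'I_n -> int) (B : 'M[K]_n), B \in unitmx /\ is_hom (sumOO e) E B.
Proof.
have [U [/finite_seqP[s sE] _ UP]] := frame_loc E None.
have [h [h0 hr hs]] := clear_poles (fun q => invmx (E q) *m E None) s.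
exists (fun=> ord None h), (h *: E None); split.
  by rewrite unitmxZ ?frame_unit // unitfE.
move=> q i j; rewrite sumOO_frameE -scalemxAr mxE.
case: q => [y|]; rewrite /twist.
  rewrite mulr1; have [Uy|Uy] := pselect (U (Some y)).
    have [r _] := UP _ Uy; apply: regularM; [exact: hr|exact: r].
  apply: hs; suff : [set` s] (Some y) by [].
  by rewrite -sE.
rewrite (mulVmx (frame_unit E None)) mulrAC; apply: regularM; last first.
  by apply: mx_regular_at_scalar; exact: regular1.
have z0 := expfz_neq0 (ord None h) (zK_neq0 F).
by rewrite /val_ge (ordM _ h0 z0) ord_zKX ord_zK mulrN1 subrr lexx orbT.
Qed.

(** Let c be a relation between the columns on the fiber at p, and i an index
with c_i nonzero for which e_i is minimal.  Column i is replaced by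
sigma^-1 * \sum_j c_j g_j b_j, where sigma is an equation of p as a section of
O(1), and g_j is a section of O(e_j - e_i) generating it at p, which exists
because e_i <= e_j whenever c_j is nonzero.  The relation makes the sum divisible
by sigma at p, and sigma is invertible elsewhere, so the new column is a section
of E(-e_i - 1). *)
Lemma raise_degree n (E : bundle F n) (e : 'I_n -> int) (B : 'M[K]_n) p :
    B \in unitmx -> is_hom (sumOO e) E B ->
    0 < ord p (\det (invmx (E p) *m B *m sumOO e p)) ->
  exists (e' : 'I_n -> int) (B' : 'M[K]_n),
    [/\ B' \in unitmx, is_hom (sumOO e') E B' & \sum_i e' i = \sum_i e i + 1].
Proof.
move=> uB hB op.
have [|c c0 cP] := degenerate_fiber (hB p).
  by rewrite /val_ge -gtz0_ge1 op orbT.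
have [i0 ci0] : exists i, c i 0 != 0.
  apply/existsP; apply: contraNT c0; rewrite negb_exists => /forallP c0.
  by apply/eqP/matrixP => i j; rewrite ord1 mxE; apply/eqP; move: (c0 i); rewrite negbK.
have [i ci imin] := @arg_minP _ _ _ i0 (fun i => c i 0 != 0) e ci0.
(* At infinity the section 1 of O(1) is an equation of the point: the local
   generator there is z. *)
pose sigma : K := if p is Some x then ('X - x%:P)%:F else 1.
have sigma0 : sigma != 0.
  by rewrite /sigma; case: (p) => [x|]; [exact: XsubC_neq0|exact: oner_neq0].
pose g j : K := if p is Some _ then 1 else zK F ^ (e j - e i).
(* G q j and S q are g_j and 1 / sigma read in the local generators at q. *)
pose G q j := g j * twist q (e i) / twist q (e j).
pose S q := twist q 1 / sigma.
have gi : g i = 1 by rewrite /g subrr; case: (p).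
have twistD q a b : twist q (a + b) = twist q a * twist q b.
  by case: q => [y|]; [exact: esym (mulr1 _)|exact: expfzDr (zK_neq0 F)].
have twistB q a b : twist q a / twist q b = twist q (a - b).
  apply: (mulIf (twist_neq0 q b)); rewrite -twistD subrK.
  by rewrite (divfK (twist_neq0 q b)).
have Gp j : G p j = 1.
  rewrite /G -mulrA twistB /g; case: (p) => [x|] /=; first by rewrite mul1r.
  by rewrite -expfzDr ?zK_neq0 // addrC subrKA subrr.
have Sp : val_ge p (-1) (S p).
  rewrite /val_ge /S (ordM _ (twist_neq0 _ _) (invr_neq0 sigma0)) (ordV _ sigma0).
  rewrite ord_twist /sigma; case: (p) => [x|].
    by rewrite ord_XsubC eqxx orbT.
  by rewrite ord_zK [ord _ 1]ord_one orbT.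
have Sq q : q != p -> val_ge q 0 (S q).
  rewrite /val_ge /S (ordM _ (twist_neq0 _ _) (invr_neq0 sigma0)) (ordV _ sigma0).
  rewrite ord_twist /sigma; case: (q) => [y|]; case: (p) => [x|] // qp.
  - have yx : (y == x) = false by apply/negP => /eqP yx; rewrite yx eqxx in qp.
    by rewrite ord_XsubC yx orbT.
  - by rewrite [ord _ 1]ord_one orbT.
  - by rewrite ord_zK ord_XsubC orbT.
have Gq q j : c j 0 != 0 -> val_ge q 0 (G q j).
  move=> /imin eij; have [->|qp] := eqVneq q p; first by rewrite Gp; exact: regular1.
  rewrite /G -mulrA twistB /g; case: q qp => [y|]; case: (p) => [x|] //= _.
  - by rewrite mulr1; exact: regular1.
  - rewrite mulr1 /val_ge ord_zKX ord_zK mulr_ge0 ?orbT ?subr_ge0 //.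
  - rewrite mul1r /val_ge ord_zKX ord_zK mulrN1 opprB subr_ge0 eij orbT //.
pose tau k : K := sigma^-1 * (constK (c k 0) * g k).
(* B *m T is B with its i-th column replaced. *)
pose T : 'M[K]_n := \matrix_(k, j) if j == i then tau k else (k == j)%:R.
have MT m (M : 'M[K]_(m, n)) r j : (M *m T) r j =
    if j == i then \sum_k M r k * tau k else M r j.
  rewrite mxE; case: eqP => ji.
    by apply: eq_bigr => k _; rewrite mxE ji eqxx.
  rewrite (bigD1 j) //= big1 ?addr0 => [|k kj]; rewrite mxE; case: eqP => // _.
    by rewrite eqxx mulr1.
  by rewrite (negbTE kj) mulr0.
have uT : T \in unitmx.
  rewrite unitmxE unitfE; apply/det0P => -[v v0 /rowP vT].
  have vj j : j != i -> v 0 j = 0.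
    by move=> ji; have := vT j; rewrite MT (negbTE ji) mxE.
  have vi : v 0 i = 0.
    have := vT i; rewrite MT eqxx (bigD1 i) //= big1 => [|k ki]; last first.
      by rewrite vj // mul0r.
    rewrite addr0 mxE => /eqP; rewrite mulf_eq0 => /orP[/eqP //|].
    by rewrite /tau gi mulr1 mulf_eq0 invr_eq0 constK_eq0 (negbTE sigma0) (negbTE ci).
  case/eqP: v0; apply/rowP => j; rewrite mxE.
  by have [->|/vj] := eqVneq j i.
exists (fun j => if j == i then e j + 1 else e j), (B *m T); split.
- by rewrite unitmx_mul uB uT.
- move=> q r j; rewrite sumOO_frameE mulmxA MT.
  have rE k : (invmx (E q) *m B *m sumOO e q) r k =
      (invmx (E q) *m B) r k * twist q (e k).
    exact: sumOO_frameE.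
  case: eqP => [->|_]; last by rewrite -rE; exact: hB.
  have -> : (\sum_k (invmx (E q) *m B) r k * tau k) * twist q (e i + 1) =
      S q * \sum_k ((invmx (E q) *m B *m sumOO e q) r k * constK (c k 0)) * G q k.
    rewrite mulr_suml mulr_sumr; apply: eq_bigr => k _.
    rewrite rE /tau /G /S twistD.
    exact: (new_column_termE _ _ _ _ _ sigma0 (twist_neq0 q (e k))).
  have [->|qp] := eqVneq q p; last first.
    apply: regularM; first exact: Sq.
    apply: val_ge_sum => k; have [->|ck] := eqVneq (c k 0) 0.
      by rewrite constK0 mulr0 mul0r; exact: val_ge0.
    apply: regularM (Gq q k ck); apply: regularM (regular_constK _ _).
    exact: hB.
  have -> : \sum_k ((invmx (E p) *m B *m sumOO e p) r k * constK (c k 0)) * G p k =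
      \sum_k (invmx (E p) *m B *m sumOO e p) r k * constK (c k 0).
    by apply: eq_bigr => k _; rewrite Gp mulr1.
  exact: (val_geM Sp (cP r)).
rewrite (bigD1 i) //= eqxx [in RHS](bigD1 i) //= addrAC; congr (_ + _ + _).
by apply: eq_bigr => j /negbTE ->.
Qed.

(** The degrees e_i are raised as long as some local determinant vanishes; the
bound \sum_i e_i <= deg E ends the process. *)
Theorem Grothendieck_splitting n (E : bundle F n) :
  exists (e : 'I_n -> int) (A : 'M[K]_n), is_iso (sumOO e) E A.
Proof.
have [e [B [uB hB]]] := exists_sumOO_hom E.
have [N] : exists N : nat, deg E < \sum_i e i + N%:Z.
  exists (absz (deg E - \sum_i e i)%R).+1.
  by move: (deg E) (\sum_i e i) => x y; lia.
(* N bounds strictly the number of times that the degrees can still be raised. *)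
elim: N e B uB hB => [|N IH] e B uB hB dN.
  have := deg_le_of_inj_hom uB hB; rewrite deg_sumOO => /le_lt_trans/(_ dN).
  by rewrite addr0 ltxx.
have [o0|] := pselect (forall p, ord p (\det (invmx (E p) *m B *m sumOO e p)) = 0).
  by exists e, B; exact: iso_of_hom.
move=> /existsNP[p /eqP op].
have {}op : 0 < ord p (\det (invmx (E p) *m B *m sumOO e p)).
  by rewrite lt_def op (ord_hom_ge0 uB hB).
have [e' [B' [uB' hB' se]]] := raise_degree uB hB op.
apply: (IH e' B' uB' hB'); move: dN; rewrite se.
by move: (deg E) (\sum_i e i) => x y; lia.
Qed.

End Splitting.

(** * Subsystems without sections *)

Section Stability.
Variable F : closedFieldType.
Local Notation K := (ratfun F).

Lemma constK_sum0 n m (b : 'I_m -> 'cV[K]_n) : \sum_i constK (0 : F) *: b i = 0.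
Proof. by rewrite big1 // => i _; rewrite constK0 scale0r. Qed.

Lemma zero_sections n (E : bundle F n) : [set (0 : 'cV[K]_n)] `<=` H0 E.
Proof. by move=> _ -> p; rewrite mulmx0 => i j; rewrite mxE; exact: val_ge0. Qed.

Lemma zero_subspace_dim n : is_subspace_of_dim 0 [set (0 : 'cV[K]_n)].
Proof.
exists (fun=> 0); split; first by move=> c _ [].
apply/seteqP; split => [v ->|v [c ->]] /=; last by rewrite big_ord0.
by exists (fun=> 0); rewrite big_ord0.
Qed.

Lemma cs_space0 n k (S : coherent_system F n k) : cs_space S 0.
Proof.
have [b [_ ->]] := cs_dim S; exists (fun=> 0); by rewrite constK_sum0.
Qed.

Definition no_sections n (E : bundle F n) : coherent_system F n 0 :=
  CoherentSystem (@zero_sections n E) (zero_subspace_dim n).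

(** A row of the inverse isomorphism retracts each stalk onto the summand. *)
Lemma col_subbundle n (e : 'I_n -> int) (E : bundle F n) (A : 'M[K]_n) i :
  is_iso (sumOO F e) E A -> is_subbundle (OO F (e i)) E (col i A).
Proof.
move=> [hA [B [hB BA AB]]].
have hcol p : invmx (E p) *m col i A *m OO F (e i) p =
    col i (invmx (E p) *m A *m sumOO F e p).
  apply/matrixP => r j; rewrite ord1 [RHS]mxE sumOO_frameE.
  rewrite [LHS]mxE big_ord1 OO_frameE; congr (_ * _).
  by rewrite colE mulmxA -colE mxE.
split=> p; first by rewrite hcol => r j; rewrite mxE; exact: hA.
exists (row i (invmx (sumOO F e p) *m B *m E p)).
  by move=> r j; rewrite mxE; exact: hB.
have e1 : invmx (sumOO F e p) *m B *m E p *m (invmx (E p) *m A *m sumOO F e p) = 1%:M.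
  rewrite !mulmxA (mulmxK (frame_unit E p)) -(mulmxA _ B) BA mulmx1.
  exact: (mulVmx (frame_unit (sumOO F e) p)).
rewrite hcol; apply/matrixP => r j; rewrite !ord1 [RHS]mxE eqxx.
move/matrixP/(_ i i): e1; rewrite [RHS]mxE eqxx => <-.
by rewrite [LHS]mxE [RHS]mxE; apply: eq_bigr => l _; rewrite [in LHS]mxE [X in _ * X]mxE.
Qed.

Lemma not_iso_line n (E' : bundle F 1) (E : bundle F n) (A : 'M[K]_(n, 1)) :
  (2 <= n)%N -> ~ is_iso E' E A.
Proof.
move=> n2 [_ [B [_ _ AB]]].
have := mxrankM_maxl A B; rewrite AB mxrank1 => le_n.
by have := leq_trans n2 (leq_trans le_n (rank_leq_col A)).
Qed.

Lemma line_subsystem n k (S : coherent_system F n k) (e : 'I_n -> int)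
    (A : 'M[K]_n) i : (2 <= n)%N -> is_iso (sumOO F e) (cs_bundle S) A ->
  is_proper_subsystem (no_sections (OO F (e i))) S (col i A).
Proof.
move=> n2 iA; split; last by case=> /(not_iso_line n2).
split; [by []|exact: col_subbundle|].
by move=> _ [_ /= -> <-]; rewrite mulmx0; exact: cs_space0.
Qed.

(** Otherwise the sum would be at most n (a - 1), which is less than n a - t. *)
Lemma exists_large_summand n (e : 'I_n -> int) (a : int) (t : nat) :
  (t < n)%N -> \sum_i e i = n%:Z * a - t%:Z -> exists i, a <= e i.
Proof.
move=> tn se; apply: contrapT => /forallNP small.
have : \sum_i e i <= \sum_(i < n) (a - 1).
  by apply: ler_sum => i _; have := small i; move: (e i) => x; lia.
rewrite sumr_const card_ord se -mulr_natl natz mulrBr mulr1.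
move: (n%:Z * a) => x; lia.
Qed.

Lemma mu_no_sections (R : realType) (alpha : R) r (S : coherent_system F r 0) :
  mu alpha S = (deg (cs_bundle S))%:~R / r%:R.
Proof. by rewrite /mu mul0r mulr0 addr0. Qed.

(** Multiplied by n, the inequality on the left reads n a < n a - t + alpha k. *)
Lemma lt_mu (R : realType) (alpha : R) n k (S : coherent_system F n k)
    (a : int) (t : nat) :
  (0 < n)%N -> (0 < k)%N -> deg (cs_bundle S) = n%:Z * a - t%:Z ->
  (a%:~R < mu alpha S) = (t%:R / k%:R < alpha).
Proof.
move=> n0 k0 dS; rewrite /mu dS mulrA -mulrDl.
rewrite ltr_pdivlMr ?ltr0n // ltr_pdivrMr ?ltr0n // rmorphB rmorphM /=.
by rewrite -!pmulrn mulrC -addrA ltrDl addrC subr_gt0.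
Qed.

(** As a is the ceiling of d / n, the integers a and t are determined by n and d. *)
Lemma generic_slope_unique (n t t' : nat) (a a' : int) : (t < n)%N -> (t' < n)%N ->
  n%:Z * a - t%:Z = n%:Z * a' - t'%:Z -> a' = a.
Proof.
have le (s s' : nat) (b b' : int) : (s' < n)%N ->
    n%:Z * b - s%:Z = n%:Z * b' - s'%:Z -> b' <= b.
  move=> s'n h; rewrite leNgt; apply/negP => bb'.
  have : n%:Z * (b + 1) <= n%:Z * b' by rewrite ler_wpM2l // lezD1.
  by rewrite mulrDr mulr1; move: h; move: (n%:Z * b) (n%:Z * b') => x y; lia.
by move=> tn t'n h; apply/eqP; rewrite eq_le (le _ _ _ _ t'n h) (le _ _ _ _ tn (esym h)).
Qed.

Lemma deg_le_of_generic n r (E : bundle F n) (E' : bundle F r) (A : 'M[K]_(n, r))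
    (a : int) (t : nat) : (t < n)%N -> deg E = n%:Z * a - t%:Z ->
  generic_splitting E -> is_subbundle E' E A -> deg E' <= r%:Z * a.
Proof.
move=> tn dE [a' [t' [t'n dE' [C [hC [D [_ DC _]]]]]]] [hA ret].
have ea : a' = a by apply: (generic_slope_unique tn t'n); rewrite -dE.
rewrite {}ea in hC.
(* The composite C *m A has a left inverse on generic fibers, obtained from the
   retraction of the stalk at any one point. *)
have [B _] := ret None; rewrite mulmxA mulmxA => /mulmx1C BA.
apply: (@deg_le_of_hom_dsum _ _ _ E' _ a (C *m A)
  (E' None *m (B *m invmx (E None)) *m D) _ (is_hom_comp hA hC)).
  by move=> i; rewrite deg_OO; case: ifP => // _; rewrite gerBl.
by rewrite -!mulmxA (mulmxA D) DC mul1mx -BA !mulmxA.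
Qed.

End Stability.

Theorem proposition4p1 (F : closedFieldType) (R : realType)
  (n : nat) (d : int) (k : nat) (alpha : R) (a : int) (t : nat)
  (n_ge2 : (2 <= n)%N) (k_gt0 : (0 < k)%N)
  (t_lt_n : (t < n)%N) (d_eq : d = n%:Z * a - t%:Z) :
  (G F alpha n d k !=set0 -> t%:R / k%:R < alpha) /\
  (forall S : coherent_system F n k,
     deg (cs_bundle S) = d ->
     generic_splitting (cs_bundle S) ->
     t%:R / k%:R < alpha ->
     forall (r : nat) (d' : int) (S' : coherent_system F r 0)
       (A : 'M[ratfun F]_(n, r)),
       deg (cs_bundle S') = d' ->
       is_subsystem S' S A ->
       mu alpha S' < mu alpha S).
Proof.
have n_gt0 : (0 < n)%N by exact: leq_trans n_ge2.
split=> [[S [dS stS]]|S dS gS ta r d' S' A dS' [r_gt0 subA _]].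
  have [e [A iA]] := Grothendieck_splitting (cs_bundle S).
  have [i ai] : exists i, a <= e i.
    apply: (exists_large_summand t_lt_n).
    by rewrite -(deg_sumOO F) (deg_iso iA) dS.
  rewrite -(lt_mu alpha n_gt0 k_gt0 (etrans dS d_eq)).
  have := stS _ _ _ _ (line_subsystem i n_ge2 iA).
  rewrite mu_no_sections deg_OO divr1; apply: le_lt_trans.
  by rewrite ler_int.
rewrite d_eq in dS; move: ta; rewrite -(lt_mu alpha n_gt0 k_gt0 dS).
apply: le_lt_trans; rewrite mu_no_sections ler_pdivrMr ?ltr0n //.
rewrite mulrC pmulrn -intrM ler_int.
exact: (deg_le_of_generic t_lt_n dS gS subA).
Qed.
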